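(* Let $m\le n$, let $Y\in\mathbb{R}^{m\times n}$ have singular values $\sigma_{Y,1}\ge\cdots\ge\sigma_{Y,m}\ge0$, and let $\mathbf{w}=(w_1,\ldots,w_m)$ be weights with $0<w_1\le w_2\le\cdots\le w_m$. For $\lambda>0$ let $\widehat{X}_{\mathbf{w}}(\lambda)=\operatorname{WSVT}_\lambda(Y)$, the solution of $\min_{X\in\mathbb{R}^{m\times n}}\|X\|_{\mathbf{w},*}+\frac{1}{2\lambda}\|Y-X\|_F^2$ obtained by applying the weighted singular value thresholding operator to $Y$. Then for any $\eta$ satisfying $0<\eta<\|Y\|_F^2$, the nonlinear equation $\psi(\lambda)\equiv\|Y-\widehat{X}_{\mathbf{w}}(\lambda)\|_F^2=\eta$ has a unique solution $\lambda>0$, namely $$\lambda=\sqrt{\Big(\eta-\sum_{i=k+1}^m\sigma_{Y,i}^2\Big)\Big/\sum_{i=1}^k w_i^2},$$ where $k\in\{1,\ldots,m\}$ is the index such that $b_{k+1}<\eta\le b_k$, with $$b_j=\Big(\frac{\sigma_{Y,j}}{w_j}\Big)^2\sum_{i=1}^j w_i^2+\sum_{i=j+1}^m\sigma_{Y,i}^2\quad (j=1,\ldots,m),\qquad b_{m+1}=0.$$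
   Context: $\|\cdot\|_F$ is the Frobenius norm. For $X\in\mathbb{R}^{m\times n}$ with singular values $\sigma_{X,1}\ge\cdots\ge\sigma_{X,m}\ge0$, the weighted nuclear norm is $\|X\|_{\mathbf{w},*}=\sum_{i=1}^m w_i\sigma_{X,i}$. Write a singular value decomposition $Y=\sum_{i=1}^m\sigma_{Y,i}\mathbf{u}_i\mathbf{v}_i^T$ with orthonormal left singular vectors $\mathbf{u}_i\in\mathbb{R}^m$ and orthonormal right singular vectors $\mathbf{v}_i\in\mathbb{R}^n$. With $(x)_+=\max(x,0)$, the weighted singular value thresholding operator is $\operatorname{WSVT}_\lambda(Y)=\sum_{i=1}^m(\sigma_{Y,i}-\lambda w_i)_+\mathbf{u}_i\mathbf{v}_i^T$. The sequence $(b_j)_{j=1}^{m+1}$ is non-increasing with $b_1=\|Y\|_F^2$, so the index $k$ exists and is unique. Empty sums are zero. *)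

(* Defs.v *)
From mathcomp Require Export all_boot all_order all_algebra.
From mathcomp Require Export boolp classical_sets reals.

Set Implicit Arguments.
Unset Strict Implicit.
Unset Printing Implicit Defensive.

Import Order.TTheory GRing.Theory Num.Theory.
Local Open Scope ring_scope.

(* The columns of U and V are the left and right singular vectors.  This is
   the thin decomposition with m triples, so it exists exactly when m <= n. *)
Definition is_svd (R : realType) (m n : nat) (A : 'M[R]_(m, n))
    (sigma : 'I_m -> R) (U : 'M[R]_m) (V : 'M[R]_(n, m)) : Prop :=
  [/\ forall i, 0 <= sigma i,
      forall i j : 'I_m, (i <= j)%N -> sigma j <= sigma i,
      U^T *m U = 1%:M,
      V^T *m V = 1%:M &
      A = \sum_i sigma i *: (col i U *m (col i V)^T)].

(* For m <= n a decomposition exists and its sigma is unique, so the default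
   value of xget is never used. *)
Definition singular_values (R : realType) (m n : nat) (A : 'M[R]_(m, n)) :
    'I_m -> R :=
  xget (fun=> 0) [set sigma | exists U V, is_svd A sigma U V]%classic.

Definition frobenius_norm (R : realType) (m n : nat) (A : 'M[R]_(m, n)) : R :=
  Num.sqrt (\sum_i \sum_j A i j ^+ 2).

Definition weighted_nuclear_norm (R : realType) (m n : nat) (w : 'I_m -> R)
    (A : 'M[R]_(m, n)) : R :=
  \sum_i w i * singular_values A i.

(* The operator takes the whole decomposition: when a singular value is
   repeated with different weights, the result depends on the chosen vectors. *)
Definition wsvt (R : realType) (m n : nat) (w sigma : 'I_m -> R)
    (U : 'M[R]_m) (V : 'M[R]_(n, m)) (lambda : R) : 'M[R]_(m, n) :=
  \sum_i Num.max (sigma i - lambda * w i) 0 *: (col i U *m (col i V)^T).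

Definition wnn_objective (R : realType) (m n : nat) (w : 'I_m -> R)
    (Y : 'M[R]_(m, n)) (lambda : R) (X : 'M[R]_(m, n)) : R :=
  weighted_nuclear_norm w X + (2 * lambda)^-1 * frobenius_norm (Y - X) ^+ 2.

Definition is_minimizer (R : realType) (T : Type) (f : T -> R) (x : T) : Prop :=
  forall y, f x <= f y.

(* Indices start at 0: [breakpoint w sigma j] is b_{j+1}, and the index j = m
   gives b_{m+1} = 0. *)
Definition breakpoint (R : realType) (m : nat) (w sigma : 'I_m -> R)
    (j : nat) : R :=
  if insub j is Some j' then
    (sigma j' / w j') ^+ 2 * (\sum_(i < m | (i <= j)%N) w i ^+ 2)
    + \sum_(i < m | (j < i)%N) sigma i ^+ 2
  else 0.

(* Main.v *)
(** Every real matrix with m <= n has a singular value decomposition, and von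
    Neumann's inequality <A, B> <= sum_i a_i b_i holds between the singular
    values a of A and b of B, because the products of the coordinates of the two
    bases are dominated by a doubly substochastic matrix.  It gives
    |A - B|_F^2 >= sum_i (a_i - b_i)^2, so the minimization decouples into scalar
    soft-thresholding problems.  For the equation, |Y - WSVT_l(Y)|_F^2 is
    the nondecreasing function sum_i min(sigma_i, l w_i)^2 of l, and b_j is its
    value at sigma_j / w_j; between consecutive ratios it is a quadratic
    in l, which is solved explicitly. *)

Require Import Defs.
From mathcomp Require Import perm complex ring lra zify.

Set Implicit Arguments.
Unset Strict Implicit.
Unset Printing Implicit Defensive.

Import Order.TTheory GRing.Theory Num.Theory.
Local Open Scope ring_scope.

(** * Existence of singular value decompositions *)

Definition dotmx (R : realType) n (x y : 'cV[R]_n) : R := \sum_i x i 0 * y i 0.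

Lemma tr_mul_dotmx (R : realType) n (x y : 'cV[R]_n) :
  x^T *m y = (dotmx x y)%:M.
Proof.
rewrite [LHS]mx11_scalar mxE; congr (_%:M).
by apply: eq_bigr => i _; rewrite mxE.
Qed.

Lemma dotmx_ge0 (R : realType) n (x : 'cV[R]_n) : 0 <= dotmx x x.
Proof. by apply: sumr_ge0 => i _; rewrite -expr2 sqr_ge0. Qed.

Lemma dotmx_eq0 (R : realType) n (x : 'cV[R]_n) : (dotmx x x == 0) = (x == 0).
Proof.
apply/idP/eqP => [|->]; last by rewrite /dotmx big1 // => i _; rewrite mxE mul0r.
rewrite psumr_eq0 => [/allP h|i _]; last by rewrite -expr2 sqr_ge0.
apply/matrixP => i j; rewrite ord1 mxE; apply/eqP.
by have := h i (mem_index_enum _); rewrite /= mulf_eq0 orbb.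
Qed.

Lemma normalize_cV (R : realType) n (x : 'cV[R]_n) : x != 0 ->
  exists2 c : R, c != 0 & (c *: x)^T *m (c *: x) = 1%:M.
Proof.
rewrite -dotmx_eq0 => x0.
exists (Num.sqrt (dotmx x x))^-1.
  by rewrite invr_eq0 sqrtr_eq0 -ltNge lt_def x0 dotmx_ge0.
rewrite -scalemxAr [(_ *: _)^T]linearZ /= -scalemxAl tr_mul_dotmx scalerA scale_scalar_mx.
by rewrite -invfM -expr2 sqr_sqrtr ?dotmx_ge0 // mulVf.
Qed.

(* Over R[i] the characteristic polynomial has a root; by symmetry it is real. *)
Lemma real_symmetric_eigenvector (R : rcfType) n (S : 'M[R]_n.+1) : S^T = S ->
  exists a : R, exists2 v : 'rV[R]_n.+1, v != 0 & v *m S = a *: v.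
Proof.
move=> Ssym.
pose f := real_complex R.
pose SC := map_mx f S.
have [mu] : exists x, root (char_poly SC) x.
  by apply/closed_rootP; rewrite size_char_poly.
rewrite -eigenvalue_root_char => /[dup] ev /eigenvalueP[v vS v0].
(* [N] is the squared Hermitian length of [v], so [mu * N] is the Hermitian form of [S] at [v]. For
   a real symmetric matrix that form equals its own conjugate. *)
pose N := \sum_i v 0 i * (v 0 i)^*%R.
have N0 : N != 0.
  rewrite /N psumr_eq0 => [|i _]; last by rewrite mul_conjC_ge0.
  apply: contra v0 => /allP h; apply/eqP/matrixP => i j; rewrite ord1 mxE; apply/eqP.
  by have := h j (mem_index_enum _); rewrite /= mul_conjC_eq0.
have E1 : mu * N = \sum_i \sum_j v 0 j * f (S j i) * (v 0 i)^*%R.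
  rewrite /N mulr_sumr; apply: eq_bigr => i _.
  have /matrixP/(_ 0 i) := vS; rewrite !mxE mulrA => <-.
  by rewrite mulr_suml; apply: eq_bigr => j _; rewrite mxE.
have fR x : (f x)^*%R = f x by apply/CrealP; apply/complex_realP; exists x.
have mu_real : mu^*%R = mu.
  apply: (mulIf N0); rewrite -[in LHS](_ : N^*%R = N); last first.
    by rewrite rmorph_sum; apply: eq_bigr => i _; rewrite rmorphM /= conjCK mulrC.
  rewrite -rmorphM E1 rmorph_sum exchange_big /=.
  apply: eq_bigr => i _; rewrite rmorph_sum; apply: eq_bigr => j _.
  rewrite !rmorphM /= conjCK fR.
  by have /matrixP/(_ j i) := Ssym; rewrite mxE => ->; rewrite mulrC -mulrA (mulrC (f _)).
have [a amu] : exists a, mu = f a.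
  by exists (complex.Re mu); rewrite /f /= RRe_real //; apply/CrealP.
exists a; suff /eigenvalueP[x xS x0] : eigenvalue S a by exists x.
by move: ev; rewrite !eigenvalue_root_char amu -map_char_poly fmorph_root.
Qed.

(** The Householder reflection in the hyperplane orthogonal to [u - e] swaps two vectors of equal
    length. When [u = e] there is no such hyperplane and the identity serves. *)
Lemma householder (R : realType) n (e u : 'cV[R]_n) :
  e^T *m e = 1%:M -> u^T *m u = 1%:M ->
  exists2 H : 'M[R]_n, H^T *m H = 1%:M & H *m e = u.
Proof.
rewrite !tr_mul_dotmx => /matrixP/(_ 0 0) + /matrixP/(_ 0 0).
rewrite !mxE /= !mulr1n => ee uu.
have [->|ne] := eqVneq u e; first by exists 1%:M; rewrite ?trmx1 ?mul1mx.
pose w := u - e.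
pose c := dotmx w w.
have c0 : c != 0 by rewrite dotmx_eq0 subr_eq0.
(* Equal lengths of [u] and [e] enter here: the reflection changes [e] by [- (2 / c) * dotmx w e]
   times [w], and this identity makes the factor 1. *)
have cE : c = - 2 * dotmx w e.
  have -> : c = dotmx u u + dotmx e e - 2 * dotmx u e.
    rewrite /c /dotmx mulr_sumr -big_split /= -sumrB; apply: eq_bigr => i _.
    by rewrite !mxE; ring.
  have -> : dotmx w e = dotmx u e - dotmx e e.
    by rewrite /dotmx -sumrB; apply: eq_bigr => i _; rewrite !mxE; ring.
  by rewrite ee uu; ring.
pose P := w *m w^T.
have PT : P^T = P by rewrite trmx_mul trmxK.
have PP : P *m P = c *: P.
  by rewrite /P mulmxA -[w *m w^T *m w]mulmxA tr_mul_dotmx mul_mx_scalar -scalemxAl.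
exists (1%:M - (2 / c) *: P).
  rewrite [_^T]linearB /= [(_ *: _)^T]linearZ /= trmx1 PT.
  rewrite mulmxBl !mulmxBr mulmx1 !mul1mx -!scalemxAl -!scalemxAr PP !scalerA.
  have -> : 2 / c * (2 / c) * c = 2 / c + 2 / c by field.
  by rewrite scalerDl opprB mulmx1 addrK subrK.
rewrite mulmxBl mul1mx -scalemxAl /P -mulmxA tr_mul_dotmx mul_mx_scalar scalerA.
have -> : 2 / c * dotmx w e = -1.
  by apply: (mulIf c0); rewrite [in RHS]cE; field.
by rewrite scaleN1r opprK addrC subrK.
Qed.

(** A unit eigenvector [u] of [A *m A^T] with eigenvalue [a] yields [s = sqrt a], and [v] is
    [A^T *m u] rescaled to unit length. If [a = 0] this vector vanishes, and [v] must come from the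
    kernel of [A] instead. *)
Lemma singular_pair (R : realType) m n (A : 'M[R]_(m.+1, n.+1)) : (m <= n)%N ->
  exists s : R, exists u : 'cV_m.+1, exists v : 'cV_n.+1, [/\ 0 <= s, u^T *m u = 1%:M, v^T *m v = 1%:M,
    A *m v = s *: u & A^T *m u = s *: v].
Proof.
move=> mn.
have [a [x x0 xS]] : exists a : R, exists2 x : 'rV_m.+1, x != 0 & x *m (A *m A^T) = a *: x.
  by apply: real_symmetric_eigenvector; rewrite trmx_mul trmxK.
have xT0 : x^T != 0 by rewrite trmx_eq0.
have [c c0 uu] := normalize_cV xT0.
set u := c *: x^T in uu.
have Au : A *m (A^T *m u) = a *: u.
  rewrite /u -!scalemxAr mulmxA; apply: trmx_inj.
  by rewrite !linearZ /= !trmx_mul !trmxK xS !scalerA mulrC.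
have aE : dotmx (A^T *m u) (A^T *m u) = a.
  suff : (dotmx (A^T *m u) (A^T *m u))%:M = a%:M :> 'M_1.
    by move/matrixP/(_ 0 0); rewrite !mxE /= !mulr1n.
  rewrite -tr_mul_dotmx trmx_mul trmxK -mulmxA Au -scalemxAr uu.
  by rewrite scale_scalar_mx mulr1.
have a_ge0 : 0 <= a by rewrite -aE dotmx_ge0.
have [a0|a0] := eqVneq a 0.
  have Au0 : A^T *m u = 0 by apply/eqP; rewrite -dotmx_eq0 aE a0.
  have u0 : u^T != 0 by rewrite trmx_eq0 scaler_eq0 negb_or c0.
  have uA0 : u^T *m A = 0 by apply: trmx_inj; rewrite trmx_mul trmxK Au0 trmx0.
  (* A trivial kernel would give [A] full column rank, so [m <= n] makes it square and invertible,
     contradicting [u^T *m A = 0] with [u] nonzero. *)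
  have : kermx A^T != 0.
    rewrite kermx_eq0; apply/negP => Af.
    have rA : \rank A = n.+1 by rewrite -mxrank_tr; apply/eqP.
    have nm : n = m by have := rank_leq_row A; rewrite rA; lia.
    suff Af' : row_free A by move: u0; rewrite -(mulmx_free_eq0 _ Af') uA0 eqxx.
    by rewrite /row_free rA nm.
  case/rowV0Pn => y /sub_kermxP yA y0.
  have yT0 : y^T != 0 by rewrite trmx_eq0.
  have [d d0 vv] := normalize_cV yT0.
  exists 0, u, (d *: y^T); split => //.
    rewrite scale0r -scalemxAr; apply: trmx_inj.
    by rewrite linearZ /= trmx_mul trmxK yA trmx0 scaler0.
  by rewrite Au0 scale0r.
have s0 : Num.sqrt a != 0 by rewrite sqrtr_eq0 -ltNge lt_def a0.
exists (Num.sqrt a), u, ((Num.sqrt a)^-1 *: (A^T *m u)); split => //.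
- by rewrite sqrtr_ge0.
- rewrite -scalemxAr [(_ *: _)^T]linearZ /= -scalemxAl tr_mul_dotmx scalerA scale_scalar_mx aE.
  by rewrite -invfM -expr2 sqr_sqrtr // mulVf.
- rewrite -scalemxAr Au scalerA; congr (_ *: _).
  by apply: (mulfI s0); rewrite mulVKf // -expr2 sqr_sqrtr.
- by rewrite scalerA mulfV // scale1r.
Qed.

Lemma svd_sumE (R : realType) m n (s : 'I_m -> R) (U : 'M[R]_m) (V : 'M[R]_(n, m)) :
  \sum_i s i *: (col i U *m (col i V)^T) = U *m diag_mx (\row_i s i) *m V^T.
Proof.
apply/matrixP => i j; rewrite summxE !mxE; apply: eq_bigr => k _.
by rewrite mul_mx_diag !mxE big_ord1 !mxE mulrCA mulrA.
Qed.

(** Deflation by induction on the number of rows: one singular pair is rotated onto the first basis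
    vectors, which leaves a smaller block to decompose. Sorting is postponed, since the induction
    does not control how [s] compares with the later values. *)
Lemma unsorted_svd (R : realType) m n (A : 'M[R]_(m, n)) : (m <= n)%N ->
  exists d : 'rV[R]_m, exists U : 'M[R]_m, exists V : 'M[R]_(n, m),
    [/\ forall i, 0 <= d 0 i, U^T *m U = 1%:M, V^T *m V = 1%:M
      & A = U *m diag_mx d *m V^T].
Proof.
elim: m n A => [|m IH] [|n] A //.
- by exists 0, 0, 0; split; try apply/matrixP; case.
- by exists 0, 0, 0; split; try apply/matrixP; case.
rewrite ltnS => mn.
have [s [u [v [s0 uu vv Av Au]]]] := singular_pair A mn.
pose e k : 'cV[R]_k.+1 := delta_mx 0 0.
have ee k : (e k)^T *m e k = 1%:M.
  rewrite trmx_delta mul_delta_mx; apply/matrixP => i j.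
  by rewrite !ord1 !mxE.
have [H HH He] := householder (ee m) uu.
have [G GG Ge] := householder (ee n) vv.
have HH' := mulmx1C HH; have GG' := mulmx1C GG.
pose B := H^T *m A *m G.
have Be : B *m e n = s *: e m.
  by rewrite /B -!mulmxA Ge Av -scalemxAr -He mulmxA HH mul1mx.
have BTe : B^T *m e m = s *: e n.
  by rewrite /B !trmx_mul trmxK -!mulmxA He Au -scalemxAr -Ge mulmxA GG mul1mx.
have AB : A = H *m B *m G^T.
  by rewrite /B !mulmxA HH' mul1mx -mulmxA GG' mulmx1.
clearbody B.
have B0 i : B i 0 = (s *: e m) i 0.
  by rewrite -Be /e -colE mxE.
have B0' j : B 0 j = (s *: e n) j 0.
  by rewrite -BTe /e -colE !mxE.
pose B' : 'M[R]_(1 + m, 1 + n) := B.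
(* [Be] fixes the first column and [BTe] the first row, so both vanish off the corner. *)
have BE : B' = block_mx s%:M 0 0 (drsubmx B').
  rewrite -[LHS]submxK; congr block_mx; apply/matrixP => i j; rewrite ?ord1 !mxE.
  - by rewrite !lshift0 B0 !mxE /= mulr1n mulr1.
  - by rewrite !lshift0 B0' !mxE /= mulr0.
  - by rewrite !lshift0 B0 !mxE /= mulr0.
have [d [U [V [d0 UU VV DE]]]] := IH n (drsubmx B') mn.
exists (row_mx s%:M d : 'rV_(1 + m)), (H *m (block_mx 1%:M 0 0 U : 'M_(1 + m))),
  (G *m (block_mx 1%:M 0 0 V : 'M_(1 + n, 1 + m))).
have d'0 (i : 'I_(1 + m)) : 0 <= row_mx s%:M d 0 i.
  case: (split_ordP i) => j ->; last by rewrite row_mxEr.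
  by rewrite row_mxEl ord1 mxE.
have orth k l (K : 'M[R]_(1 + k)) (W : 'M[R]_(k, l)) :
    K^T *m K = 1%:M -> W^T *m W = 1%:M ->
    (K *m block_mx 1%:M 0 0 W)^T *m (K *m block_mx 1%:M 0 0 W) = 1%:M.
  move=> KK WW; rewrite trmx_mul -mulmxA (mulmxA K^T) KK mul1mx tr_block_mx.
  rewrite mulmx_block !trmx0 trmx1 WW !mulmx0 !mul0mx !mul1mx !addr0 !add0r.
  by rewrite -scalar_mx_block.
have blockE (K : 'M[R]_(1 + m)) (L : 'M[R]_(1 + n)) :
    K *m block_mx s%:M 0 0 (U *m diag_mx d *m V^T) *m L^T =
    K *m block_mx 1%:M 0 0 U *m diag_mx (row_mx s%:M d)
      *m (L *m block_mx 1%:M 0 0 V)^T.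
  rewrite trmx_mul !mulmxA -!(mulmxA K) diag_mx_row tr_block_mx !mulmx_block.
  rewrite !(trmx0, trmx1, mulmx0, mul0mx, mul1mx, mulmx1, addr0, add0r).
  suff -> : diag_mx (s%:M : 'rV_1) = s%:M by [].
  by apply/matrixP => i j; rewrite !ord1 !mxE.
split; [exact: d'0|exact: orth|exact: orth|].
by rewrite AB -[B]/B' BE DE; exact: blockE.
Qed.

Lemma antitone_perm (R : realType) m (s : 'I_m -> R) :
  exists p : 'S_m, forall i j : 'I_m, (i <= j)%N -> s (p j) <= s (p i).
Proof.
pose t := [tuple s i | i < m].
pose t' := sort >=%O t.
have szt' : size t' = m by rewrite size_sort size_tuple.
have /tuple_permP[p tE] : perm_eq t' t by rewrite perm_sort.
exists p => i j ij.
have tp k : s (p k) = nth 0 t' k.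
  rewrite tE /= (nth_map k) ?size_enum_ord // nth_ord_enum /=.
  by rewrite (tnth_map) tnth_ord_tuple.
rewrite !tp.
have st : sorted >=%O t' by apply: sort_sorted => x y; apply: le_total.
by apply: (sorted_leq_nth ge_trans ge_refl 0 st); rewrite ?inE ?szt'.
Qed.

Lemma svd_exists (R : realType) m n (A : 'M[R]_(m, n)) : (m <= n)%N ->
  exists sigma, exists U, exists V, is_svd A sigma U V.
Proof.
move=> mn; have [d [U [V [d0 UU VV AE]]]] := unsorted_svd A mn.
have [p pmono] := antitone_perm (fun i => d 0 i).
exists (fun i => d 0 (p i)), (col_perm p U), (col_perm p V).
have orth k (W : 'M[R]_(k, m)) : W^T *m W = 1%:M ->
    (col_perm p W)^T *m col_perm p W = 1%:M.
  move/matrixP => WW; apply/matrixP => i j; rewrite mxE.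
  have := WW (p i) (p j); rewrite !mxE (inj_eq perm_inj) => <-.
  by apply: eq_bigr => l _; rewrite !mxE.
split=> //; [exact: orth|exact: orth|].
rewrite AE -[d in LHS](_ : \row_i d 0 i = d); last by apply/rowP => i; rewrite mxE.
rewrite -svd_sumE (reindex_inj (@perm_inj _ p)); apply: eq_bigr => i _.
by congr (_ *: (_ *m _^T)); apply/matrixP => k l; rewrite !mxE.
Qed.

(** * Von Neumann's trace inequality and uniqueness of singular values *)

(** The Frobenius inner product, in trace form so that factors can be permuted cyclically. *)
Definition mxdot (R : realType) m n (A B : 'M[R]_(m, n)) : R := \tr (A *m B^T).

Lemma frobenius_normE (R : realType) m n (A : 'M[R]_(m, n)) :
  frobenius_norm A ^+ 2 = mxdot A A.
Proof.
rewrite sqr_sqrtr; last by do 2![apply: sumr_ge0 => ? _]; rewrite sqr_ge0.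
by apply: eq_bigr => i _; rewrite mxE; apply: eq_bigr => j _; rewrite mxE expr2.
Qed.

Lemma mxdotC (R : realType) m n (A B : 'M[R]_(m, n)) : mxdot A B = mxdot B A.
Proof. by rewrite /mxdot -mxtrace_tr trmx_mul trmxK. Qed.

Lemma mxdotBB (R : realType) m n (A B : 'M[R]_(m, n)) :
  mxdot (A - B) (A - B) = mxdot A A - 2 * mxdot A B + mxdot B B.
Proof.
rewrite {1}/mxdot [(A - B)^T]linearB /= mulmxBl !mulmxBr !raddfB /= -!/(mxdot _ _).
by rewrite (mxdotC B A); ring.
Qed.

(** The inner product of two rank-one matrices factors into the dot product of their left vectors
    times that of their right vectors. *)
Lemma mxdot_rank1_sums (R : realType) m n (a b : 'I_m -> R)
    (U U' : 'M[R]_m) (V V' : 'M[R]_(n, m)) :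
  mxdot (\sum_i a i *: (col i U *m (col i V)^T))
        (\sum_i b i *: (col i U' *m (col i V')^T)) =
  \sum_i \sum_j a i * b j * ((U^T *m U') i j * (V^T *m V') i j).
Proof.
have dotE k (W W' : 'M[R]_(k, m)) i j : (W^T *m W') i j = dotmx (col i W) (col j W').
  by rewrite mxE; apply: eq_bigr => l _; rewrite !mxE.
rewrite /mxdot mulmx_suml raddf_sum; apply: eq_bigr => i _ /=.
rewrite raddf_sum mulmx_sumr raddf_sum; apply: eq_bigr => j _ /=.
rewrite [(_ *: _)^T]linearZ /= -scalemxAl -scalemxAr scalerA mxtraceZ; congr (_ * _).
rewrite trmx_mul trmxK mulmxA -(mulmxA (col i U)) tr_mul_dotmx mul_mx_scalar.
rewrite -scalemxAl mxtraceZ mxtrace_mulC -mxtrace_tr trmx_mul trmxK tr_mul_dotmx.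
by rewrite mxtrace_scalar mulr1n mulrC !dotE.
Qed.

Lemma mxdot_orthonormal (R : realType) m n (a b : 'I_m -> R)
    (U : 'M[R]_m) (V : 'M[R]_(n, m)) : U^T *m U = 1%:M -> V^T *m V = 1%:M ->
  mxdot (\sum_i a i *: (col i U *m (col i V)^T))
        (\sum_i b i *: (col i U *m (col i V)^T)) = \sum_i a i * b i.
Proof.
move=> UU VV; rewrite mxdot_rank1_sums UU VV; apply: eq_bigr => i _.
rewrite (bigD1 i) //= big1 => [|j ji]; first by rewrite !mxE eqxx !mulr1 addr0.
by rewrite !mxE eq_sym (negPf ji) !mulr0.
Qed.

(** The sum is the squared length of the coordinate vector [x] of a unit column of [V] along the
    columns of [V']; its gap to 1 is the squared length of the residual [v - V' *m x]. *)
Lemma bessel (R : realType) m n (V V' : 'M[R]_(n, m)) (i : 'I_m) :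
  V^T *m V = 1%:M -> V'^T *m V' = 1%:M -> \sum_j (V^T *m V') i j ^+ 2 <= 1.
Proof.
move=> VV VV'; pose v := col i V; pose x := V'^T *m v.
have vv : v^T *m v = 1%:M.
  rewrite [LHS]mx11_scalar; congr (_%:M); move/matrixP/(_ i i): VV.
  by rewrite !mxE eqxx => VVi; rewrite -[RHS]VVi; apply: eq_bigr => j _; rewrite !mxE.
have -> : \sum_j (V^T *m V') i j ^+ 2 = dotmx x x.
  apply: eq_bigr => j _; rewrite -expr2; congr (_ ^+ 2).
  by rewrite !mxE; apply: eq_bigr => l _; rewrite !mxE mulrC.
rewrite -subr_ge0; suff -> : 1 - dotmx x x = dotmx (v - V' *m x) (v - V' *m x).
  exact: dotmx_ge0.
have : (v - V' *m x)^T *m (v - V' *m x) = 1%:M - x^T *m x.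
  rewrite [_^T]linearB /= mulmxBl !mulmxBr vv.
  rewrite trmx_mul -!mulmxA (mulmxA V'^T V') VV' mul1mx -/x subrr subr0.
  by congr (_ - _); rewrite mulmxA /x trmx_mul trmxK.
rewrite !tr_mul_dotmx => /matrixP/(_ 0 0).
by rewrite !mxE /= !mulr1n.
Qed.

(** Summation by parts, done by induction: subtracting the last coefficient from all others keeps
    them nonnegative and nonincreasing, and what is split off is that coefficient times the full sum
    of [d]. *)
Lemma abel_ge0 (R : realDomainType) m (a d : 'I_m -> R) :
  (forall i, 0 <= a i) -> (forall i j : 'I_m, (i <= j)%N -> a j <= a i) ->
  (forall k : 'I_m, 0 <= \sum_(i < m | (i <= k)%N) d i) ->
  0 <= \sum_i a i * d i.
Proof.
elim: m a d => [|m IH] a d a0 amono dk; first by rewrite big_ord0.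
have -> : \sum_i a i * d i =
    \sum_(i < m) (a (widen_ord (leqnSn m) i) - a ord_max) * d (widen_ord (leqnSn m) i)
    + a ord_max * \sum_i d i.
  rewrite !big_ord_recr /= mulrDr mulr_sumr addrA -big_split /=; congr (_ + _).
  by apply: eq_bigr => i _; rewrite mulrBl subrK.
apply: addr_ge0.
  apply: IH => [i|i j ij|k].
  - by rewrite subr_ge0 amono //= ltnW.
  - by rewrite lerD2r amono.
  have := dk (widen_ord (leqnSn m) k); rewrite big_mkcond big_ord_recr /=.
  by rewrite leqNgt ltn_ord /= addr0 -big_mkcond.
apply: mulr_ge0 => //; have := dk ord_max.
by rewrite (eq_bigl predT) // => i; rewrite /= -ltnS ltn_ord.
Qed.

Lemma substochastic_rearrangement (R : realDomainType) m (a b : 'I_m -> R)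
    (M : 'I_m -> 'I_m -> R) :
  (forall i, 0 <= a i) -> (forall i j : 'I_m, (i <= j)%N -> a j <= a i) ->
  (forall i, 0 <= b i) -> (forall i j : 'I_m, (i <= j)%N -> b j <= b i) ->
  (forall i j, 0 <= M i j) ->
  (forall i, \sum_j M i j <= 1) -> (forall j, \sum_i M i j <= 1) ->
  \sum_i \sum_j a i * b j * M i j <= \sum_i a i * b i.
Proof.
move=> a0 amono b0 bmono M0 Mrow Mcol.
rewrite -subr_ge0 -sumrB.
rewrite (eq_bigr (fun i => a i * (b i - \sum_j b j * M i j))); last first.
  move=> i _; rewrite mulrBr mulr_sumr; congr (_ - _).
  by apply: eq_bigr => j _; rewrite mulrA.
apply: abel_ge0 => // k; rewrite sumrB exchange_big /=.
pose c j := \sum_(i < m | (i <= k)%N) M i j.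
have c0 j : 0 <= c j by apply: sumr_ge0.
have c1 j : c j <= 1.
  apply: le_trans (Mcol j); rewrite /c big_mkcond; apply: ler_sum => i _.
  by case: ifP.
have csum : \sum_j c j <= \sum_(i < m | (i <= k)%N) 1.
  by rewrite exchange_big; apply: ler_sum.
have -> : \sum_(i < m | (i <= k)%N) b i -
    \sum_j \sum_(i < m | (i <= k)%N) b j * M i j =
    \sum_(j < m) b j * ((j <= k)%N%:R - c j).
  rewrite big_mkcond -sumrB; apply: eq_bigr => j _.
  by rewrite -mulr_sumr mulrBr; case: ifP => _; rewrite ?mulr1 ?mulr0.
(* Replacing [b j] by the constant [b k] only lowers the sum: the factor is [1 - c j >= 0] when
   [j <= k], where [b j >= b k], and [- c j <= 0] beyond, where [b j <= b k]. With the constant, the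
   total mass of [c] decides the sign. *)
have : 0 <= \sum_(j < m) b k * ((j <= k)%N%:R - c j).
  rewrite -mulr_sumr mulr_ge0 // sumrB subr_ge0 (le_trans csum) //.
  by rewrite big_mkcond; apply: ler_sum => j _; case: ifP.
move=> /le_trans; apply; apply: ler_sum => j _; have [jk|kj] := leqP j k.
  by rewrite ler_wpM2r ?subr_ge0 // bmono.
by rewrite sub0r !mulrN lerN2 ler_wpM2r // bmono // ltnW.
Qed.

(** By [p * q <= (p ^+ 2 + q ^+ 2) / 2], each product of coordinates is at most the entry of [M],
    whose row and column sums are at most 1 by Bessel's inequality. *)
Lemma von_neumann_trace (R : realType) m n (A B : 'M[R]_(m, n))
    (a b : 'I_m -> R) U V U' V' : is_svd A a U V -> is_svd B b U' V' ->
  mxdot A B <= \sum_i a i * b i.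
Proof.
case=> a0 amono UU VV -> [b0 bmono UU' VV' ->]; rewrite mxdot_rank1_sums.
pose M i j : R := ((U^T *m U') i j ^+ 2 + (V^T *m V') i j ^+ 2) / 2.
have MT k (W W' : 'M[R]_(k, m)) i j : (W^T *m W') i j = (W'^T *m W) j i.
  by rewrite !mxE; apply: eq_bigr => l _; rewrite !mxE mulrC.
have half (x y : 'I_m -> R) : \sum_i x i <= 1 -> \sum_i y i <= 1 ->
    \sum_i (x i + y i) / 2 <= 1.
  by move=> hx hy; rewrite -mulr_suml big_split /=; lra.
apply: (@le_trans _ _ (\sum_i \sum_j a i * b j * M i j)).
  apply: ler_sum => i _; apply: ler_sum => j _; apply: ler_wpM2l.
    exact: mulr_ge0.
  rewrite /M; move: ((U^T *m U') i j) ((V^T *m V') i j) => p q.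
  by have := sqr_ge0 (p - q); rewrite sqrrB; lra.
apply: substochastic_rearrangement => // [i j|i|j].
- by rewrite divr_ge0 // addr_ge0 ?sqr_ge0.
- by apply: half; apply: bessel.
- apply: half; under eq_bigr do rewrite MT; exact: bessel.
Qed.

(* Applied to A and itself, von Neumann's inequality for the two decompositions
   gives sum_i (s_i - s'_i)^2 <= 0. *)
Lemma singular_values_unique (R : realType) m n (A : 'M[R]_(m, n))
    (s s' : 'I_m -> R) U V U' V' : is_svd A s U V -> is_svd A s' U' V' -> s = s'.
Proof.
move=> svd svd'; have := von_neumann_trace svd svd'.
have AA t W X : is_svd A t W X -> mxdot A A = \sum_i t i * t i.
  by case=> _ _ WW XX ->; rewrite mxdot_orthonormal.
move=> le; have {}le : \sum_i (s i - s' i) ^+ 2 <= 0.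
  rewrite (eq_bigr (fun i => s i * s i + s' i * s' i - 2 * (s i * s' i))); last first.
    by move=> i _; ring.
  rewrite sumrB big_split /= -mulr_sumr -(AA _ _ _ svd) -(AA _ _ _ svd'); lra.
have /eqP : \sum_i (s i - s' i) ^+ 2 = 0.
  by apply/eqP; rewrite eq_le le sumr_ge0 // => i _; rewrite sqr_ge0.
rewrite psumr_eq0 => [/allP h|i _]; last exact: sqr_ge0.
apply: funext => i; apply/eqP; rewrite -subr_eq0 -sqrf_eq0.
exact: h (mem_index_enum i).
Qed.

Lemma singular_valuesE (R : realType) m n (A : 'M[R]_(m, n)) s U V :
  is_svd A s U V -> singular_values A = s.
Proof.
move=> svd; rewrite /singular_values; case: xgetP => [t _ [U' [V' svd']]|].
  exact: singular_values_unique svd' svd.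
by move=> /(_ s) []; exists U, V.
Qed.

Lemma svd_dist_le (R : realType) m n (A B : 'M[R]_(m, n))
    (a b : 'I_m -> R) U V U' V' : is_svd A a U V -> is_svd B b U' V' ->
  \sum_i (a i - b i) ^+ 2 <= frobenius_norm (A - B) ^+ 2.
Proof.
move=> svdA svdB; have := von_neumann_trace svdA svdB.
rewrite frobenius_normE mxdotBB.
case: svdA svdB => _ _ UU VV AE [_ _ UU' VV' BE].
have -> : mxdot A A = \sum_i a i * a i by rewrite {1 2}AE mxdot_orthonormal.
have -> : mxdot B B = \sum_i b i * b i by rewrite {1 2}BE mxdot_orthonormal.
have -> : \sum_i (a i - b i) ^+ 2 =
    \sum_i a i * a i - 2 * (\sum_i a i * b i) + \sum_i b i * b i.
  rewrite mulr_sumr -sumrB -big_split; apply: eq_bigr => i _ /=; ring.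
lra.
Qed.

(** * Minimality of weighted singular value thresholding *)

(** Increasing weights keep the shrunken values in order, so the same singular vectors serve and the
    nuclear norm of the thresholded matrix can be read off. *)
Lemma svd_wsvt (R : realType) m n (Y : 'M[R]_(m, n)) (w sigma : 'I_m -> R) U V
    (lambda : R) :
  is_svd Y sigma U V -> (forall i j : 'I_m, (i <= j)%N -> w i <= w j) ->
  0 < lambda ->
  is_svd (wsvt w sigma U V lambda) (fun i => Num.max (sigma i - lambda * w i) 0) U V.
Proof.
case=> s0 smono UU VV _ wmono l0; split=> // [i|i j ij].
  by rewrite le_max lexx orbT.
have := smono _ _ ij; have := wmono _ _ ij => wij sij.
have : lambda * w i <= lambda * w j by rewrite ler_pM2l.
by rewrite ge_max !le_max lexx orbT andbT => ?; apply/orP; left; lra.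
Qed.

Lemma frobenius_sub_wsvt (R : realType) m n (Y : 'M[R]_(m, n))
    (w sigma : 'I_m -> R) U V (lambda : R) : is_svd Y sigma U V ->
  frobenius_norm (Y - wsvt w sigma U V lambda) ^+ 2 =
  \sum_i (sigma i - Num.max (sigma i - lambda * w i) 0) ^+ 2.
Proof.
case=> _ _ UU VV ->; rewrite frobenius_normE -sumrB.
under eq_bigr do rewrite -scalerBl.
by rewrite mxdot_orthonormal.
Qed.

(** After clearing [2 * l], the gap is [(x - (s - l * c)) ^+ 2] if the threshold is active at a
    positive value, and [x ^+ 2 + 2 * (x * (l * c - s))] if it is zero. *)
Lemma soft_threshold_min (R : realFieldType) (s c l x : R) : 0 < l -> 0 <= x ->
  c * Num.max (s - l * c) 0 + (2 * l)^-1 * (s - Num.max (s - l * c) 0) ^+ 2 <=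
  c * x + (2 * l)^-1 * (s - x) ^+ 2.
Proof.
move=> l0 x0; have l20 : 0 < 2 * l by rewrite mulr_gt0.
have cE y : c * y + (2 * l)^-1 * (s - y) ^+ 2 =
    (2 * l)^-1 * (2 * l * (c * y) + (s - y) ^+ 2).
  by rewrite mulrDr mulKf // gt_eqF.
rewrite !cE ler_pM2l ?invr_gt0 //.
have [h|h] := leP (s - l * c) 0; last first.
  rewrite -subr_ge0.
  have -> : 2 * l * (c * x) + (s - x) ^+ 2 - (2 * l * (c * (s - l * c)) +
     (s - (s - l * c)) ^+ 2) = (x - (s - l * c)) ^+ 2 by ring.
  exact: sqr_ge0.
have : 0 <= x * (l * c - s) by rewrite mulr_ge0 // subr_ge0 -subr_le0.
have := sqr_ge0 x; rewrite mulr0 mulr0 subr0 add0r => h1 h2.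
rewrite -subr_ge0.
have -> : 2 * l * (c * x) + (s - x) ^+ 2 - s ^+ 2 = x ^+ 2 + 2 * (x * (l * c - s)) by ring.
by rewrite addr_ge0 // mulr_ge0.
Qed.

Lemma wsvt_minimizer (R : realType) m n (Y : 'M[R]_(m, n)) (w sigma : 'I_m -> R)
    U V (lambda : R) : (m <= n)%N -> is_svd Y sigma U V ->
  (forall i j : 'I_m, (i <= j)%N -> w i <= w j) -> 0 < lambda ->
  is_minimizer (wnn_objective w Y lambda) (wsvt w sigma U V lambda).
Proof.
move=> mn svdY wmono l0 X; have [t [U' [V' svdX]]] := svd_exists X mn.
rewrite /wnn_objective /weighted_nuclear_norm (singular_valuesE svdX).
rewrite (singular_valuesE (svd_wsvt svdY wmono l0)) (frobenius_sub_wsvt _ _ svdY).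
have l20 : 0 < (2 * lambda)^-1 by rewrite invr_gt0 mulr_gt0.
(* The intermediate bound depends on [X] only through its singular values [t], so each index is
   minimized separately. *)
apply: (@le_trans _ _ (\sum_i w i * t i + (2 * lambda)^-1 * \sum_i (sigma i - t i) ^+ 2)).
  rewrite !mulr_sumr -!big_split; apply: ler_sum => i _ /=.
  by apply: soft_threshold_min => //; case: svdX.
by rewrite lerD2l ler_pM2l //; exact: svd_dist_le svdY svdX.
Qed.

(** * The scalar residual equation and its root *)

(** A residual below its maximal value leaves some index with [l * w i < sigma i], and the term at
    that index grows strictly. *)
Lemma residual_strict_mono (R : realDomainType) m (w sigma : 'I_m -> R) (l l' : R) :
  (forall i, 0 < w i) -> (forall i, 0 <= sigma i) -> 0 < l -> l < l' ->
  \sum_i Num.min (sigma i) (l * w i) ^+ 2 < \sum_i sigma i ^+ 2 ->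
  \sum_i Num.min (sigma i) (l * w i) ^+ 2 < \sum_i Num.min (sigma i) (l' * w i) ^+ 2.
Proof.
move=> w0 s0 l0 ll' lt.
have m0 k i : 0 <= k -> 0 <= Num.min (sigma i) (k * w i).
  by move=> k0; rewrite le_min s0 mulr_ge0 // ltW.
have [l0' l'0] : 0 <= l /\ 0 <= l' by split; lra.
have lw i : l * w i < l' * w i by rewrite ltr_pM2r.
have [i si] : exists i, l * w i < sigma i.
  apply/existsP; apply: contraLR lt; rewrite -leNgt => /existsPn h.
  apply: ler_sum => i _; by rewrite min_l // leNgt h.
rewrite [ltLHS](bigD1 i) // [ltRHS](bigD1 i) //=; apply: ltr_leD.
  rewrite ltr_pXn2r ?nnegrE ?m0 //.
  by rewrite [in ltLHS]min_r ?ltW // lt_min si lw.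
apply: ler_sum => j _; rewrite ler_pXn2r ?nnegrE ?m0 //.
by rewrite le_min ge_min lexx /= ge_min (ltW (lw j)) orbT.
Qed.

Lemma residual_split (R : realType) m (w sigma : 'I_m -> R) (l : R) (k : nat) :
  (forall i : 'I_m, (i <= k)%N -> l * w i <= sigma i) ->
  (forall i : 'I_m, (k < i)%N -> sigma i <= l * w i) ->
  \sum_i Num.min (sigma i) (l * w i) ^+ 2 =
  l ^+ 2 * (\sum_(i < m | (i <= k)%N) w i ^+ 2) + \sum_(i < m | (k < i)%N) sigma i ^+ 2.
Proof.
move=> lo hi; rewrite (bigID (fun i : 'I_m => (i <= k)%N)) /= mulr_sumr.
congr (_ + _); first by apply: eq_bigr => i ik; rewrite min_r ?lo // exprMn.
under eq_bigl do rewrite -ltnNge.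
by apply: eq_bigr => i ki; rewrite min_l ?hi.
Qed.

Lemma residual_mono (R : realType) m (w sigma : 'I_m -> R) (l l' : R) :
  (forall i, 0 < w i) -> (forall i, 0 <= sigma i) -> 0 <= l -> l <= l' ->
  \sum_i Num.min (sigma i) (l * w i) ^+ 2 <= \sum_i Num.min (sigma i) (l' * w i) ^+ 2.
Proof.
move=> w0 s0 l0 ll'; apply: ler_sum => i _.
have l'0 := le_trans l0 ll'.
have m0 k : 0 <= k -> 0 <= Num.min (sigma i) (k * w i).
  by move=> k0; rewrite le_min s0 mulr_ge0 // ltW.
by rewrite ler_pXn2r ?nnegrE ?m0 // le_min ge_min lexx /= ge_min ler_pM2r // ll' orbT.
Qed.

Lemma ratio_antitone (R : realType) m (w sigma : 'I_m -> R) :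
  (forall i, 0 < w i) -> (forall i, 0 <= sigma i) ->
  (forall i j : 'I_m, (i <= j)%N -> w i <= w j) ->
  (forall i j : 'I_m, (i <= j)%N -> sigma j <= sigma i) ->
  forall i j : 'I_m, (i <= j)%N -> sigma j / w j <= sigma i / w i.
Proof.
move=> w0 s0 wmono smono i j ij; apply: ler_pM => //.
- by rewrite invr_ge0 ltW.
- exact: smono.
- by rewrite lef_pV2 ?posrE // wmono.
Qed.

Lemma breakpointE (R : realType) m (w sigma : 'I_m -> R) (j : 'I_m) :
  breakpoint w sigma j = (sigma j / w j) ^+ 2 * (\sum_(i < m | (i <= j)%N) w i ^+ 2)
    + \sum_(i < m | (j < i)%N) sigma i ^+ 2.
Proof. by rewrite /breakpoint valK. Qed.

(** Since the ratios are nonincreasing, at [l = sigma j / w j] the minimum is [l * w i] up to index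
    [j] and [sigma i] after it. *)
Lemma breakpoint_residual (R : realType) m (w sigma : 'I_m -> R) (j : 'I_m) :
  (forall i, 0 < w i) ->
  (forall i j : 'I_m, (i <= j)%N -> sigma j / w j <= sigma i / w i) ->
  breakpoint w sigma j = \sum_i Num.min (sigma i) (sigma j / w j * w i) ^+ 2.
Proof.
move=> w0 ratio; rewrite breakpointE -residual_split // => i ij.
  by rewrite -ler_pdivlMr // ratio.
by rewrite -ler_pdivrMr // ratio // ltnW.
Qed.

Lemma residual_root (R : realType) m (w sigma : 'I_m -> R) (eta : R) :
  (forall i, 0 < w i) -> (forall i, 0 <= sigma i) ->
  (forall i j : 'I_m, (i <= j)%N -> w i <= w j) ->
  (forall i j : 'I_m, (i <= j)%N -> sigma j <= sigma i) ->
  0 < eta -> eta < \sum_i sigma i ^+ 2 ->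
  exists k : 'I_m,
    unique (fun k' : 'I_m =>
      breakpoint w sigma k'.+1 < eta /\ eta <= breakpoint w sigma k') k /\
    unique (fun l => 0 < l /\ \sum_i Num.min (sigma i) (l * w i) ^+ 2 = eta)
      (Num.sqrt ((eta - \sum_(i < m | (k < i)%N) sigma i ^+ 2)
                 / (\sum_(i < m | (i <= k)%N) w i ^+ 2))).
Proof.
move=> w0 s0 wmono smono eta0 eta_lt.
have ratio := ratio_antitone w0 s0 wmono smono.
have ratio0 i : 0 <= sigma i / w i by rewrite divr_ge0 // ltW.
have m_gt0 : (0 < m)%N.
  case: (posnP m) => // m0; move: eta_lt; rewrite big1 => [|i _]; first by lra.
  by have := ltn_ord i; rewrite {2}m0.
pose P j := eta <= breakpoint w sigma j.
have P0 : P 0%N.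
  rewrite /P (breakpoint_residual (Ordinal m_gt0)) // (le_trans (ltW eta_lt)) //.
  apply: ler_sum => i _; rewrite min_l // -ler_pdivrMr //; exact: ratio.
(* Outside the range [breakpoint] is 0, which lies below [eta]; this bounds the indices satisfying
   [P], and [k] is the largest of them. *)
have Plt j : P j -> (j < m)%N.
  by rewrite /P /breakpoint; case: insubP => // _; rewrite leNgt eta0.
have exP : exists j, P j by exists 0%N.
have [k0 Pk0 kmax] := ex_maxnP exP (fun j Pj => ltnW (Plt j Pj)).
pose k := Ordinal (Plt _ Pk0); exists k.
have Pk : eta <= breakpoint w sigma k by [].
have Pk1 : breakpoint w sigma k.+1 < eta.
  by rewrite ltNge; apply/negP => /kmax; rewrite ltnn.
have bp_lt (i j : 'I_m) : (i < j)%N -> breakpoint w sigma j <= breakpoint w sigma i.+1.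
  move=> ij; have i1m : (i.+1 < m)%N by apply: leq_ltn_trans ij _.
  rewrite (breakpoint_residual (Ordinal i1m)) // (breakpoint_residual j) //.
  by apply: residual_mono => //; apply: ratio.
split.
  split=> // k' [lt' le']; apply: val_inj => /=.
  have [kk'|k'k|//] := ltngtP k k'.
    by have := le_lt_trans (le_trans le' (bp_lt _ _ kk')) Pk1; rewrite ltxx.
  by have := le_lt_trans (le_trans Pk (bp_lt _ _ k'k)) lt'; rewrite ltxx.
set T := \sum_(i < m | (k < i)%N) _; set W := \sum_(i < m | (i <= k)%N) _.
have W0 : 0 < W.
  rewrite /W (bigD1 k) //= ltr_wpDr ?exprn_gt0 //.
  by apply: sumr_ge0 => i _; rewrite sqr_ge0.
set l := Num.sqrt _.
have [etaT hi] : T < eta /\ forall i : 'I_m, (k < i)%N -> sigma i <= l * w i.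
  have [k1m|mk1] := ltnP k.+1 m; last first.
    have none (i : 'I_m) : (k < i)%N = false.
      by apply/negP => /leq_ltn_trans/(_ (ltn_ord i)); rewrite ltnNge mk1.
    by split=> [|i]; rewrite ?none // /T big_pred0.
  pose j := Ordinal k1m.
  (* At the ratio of [j = k + 1] the two arguments of the minimum agree at index [j], so the split
     may be made after [k] instead of after [j]. Then [breakpoint w sigma j < eta] says that [l]
     exceeds this ratio. *)
  have bj : breakpoint w sigma j = (sigma j / w j) ^+ 2 * W + T.
    rewrite breakpoint_residual // (@residual_split _ _ _ _ _ k) // => i ik.
      by rewrite -ler_pdivlMr // ratio //= ltnW.
    by rewrite -ler_pdivrMr // ratio.
  move: Pk1; rewrite -[k.+1]/(j : nat) bj => lt_eta.
  have rW : 0 <= (sigma j / w j) ^+ 2 * W by rewrite mulr_ge0 ?sqr_ge0 // ltW.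
  split=> [|i ki]; first by lra.
  rewrite -ler_pdivrMr // (le_trans (ratio j i _)) // -[leLHS]ger0_norm //.
  by rewrite -sqrtr_sqr ler_wsqrtr // ler_pdivlMr // lerBrDr ltW.
have l2 : l ^+ 2 = (eta - T) / W by rewrite sqr_sqrtr // divr_ge0 ?ltW // subr_gt0.
have l0 : 0 < l by rewrite sqrtr_gt0 divr_gt0 // subr_gt0.
(* On squares, [eta <= breakpoint w sigma k] says exactly that [l] is at most the ratio at [k]. *)
have lo (i : 'I_m) : (i <= k)%N -> l * w i <= sigma i.
  move=> ik; rewrite -ler_pdivlMr // (le_trans _ (ratio i k ik)) //.
  rewrite -(@ler_pXn2r _ 2) ?nnegrE ?(ltW l0) // l2 ler_pdivrMr // lerBlDr.
  by rewrite -breakpointE.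
have root : \sum_i Num.min (sigma i) (l * w i) ^+ 2 = eta.
  by rewrite (residual_split lo hi) -/W -/T l2 divfK ?gt_eqF // subrK.
split=> // l' [l'0 root']; have [ll'|l'l|//] := ltgtP l l'.
  by have := residual_strict_mono w0 s0 l0 ll'; rewrite root root' ltxx => /(_ eta_lt).
by have := residual_strict_mono w0 s0 l'0 l'l; rewrite root root' ltxx => /(_ eta_lt).
Qed.

Theorem theorem4p4 (R : realType) (m n : nat) (hmn : (m <= n)%N)
    (Y : 'M[R]_(m, n)) (sigma : 'I_m -> R) (U : 'M[R]_m) (V : 'M[R]_(n, m))
    (hY : is_svd Y sigma U V)
    (w : 'I_m -> R) (w_gt0 : forall i, 0 < w i)
    (w_mono : forall i j : 'I_m, (i <= j)%N -> w i <= w j) :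
  let Xhat := wsvt w sigma U V in
  let psi := fun lambda : R => frobenius_norm (Y - Xhat lambda) ^+ 2 in
  (forall lambda : R, 0 < lambda ->
     is_minimizer (wnn_objective w Y lambda) (Xhat lambda)) /\
  (forall eta : R, 0 < eta -> eta < frobenius_norm Y ^+ 2 ->
     exists k : 'I_m,
       unique (fun k' : 'I_m =>
         breakpoint w sigma k'.+1 < eta /\ eta <= breakpoint w sigma k') k /\
       unique (fun lambda : R => 0 < lambda /\ psi lambda = eta)
         (Num.sqrt ((eta - \sum_(i < m | (k < i)%N) sigma i ^+ 2)
                    / (\sum_(i < m | (i <= k)%N) w i ^+ 2)))).
Proof.
move=> Xhat psi; split=> [lambda|eta eta0]; first exact: wsvt_minimizer.
have psiE l : psi l = \sum_i Num.min (sigma i) (l * w i) ^+ 2.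
  rewrite /psi frobenius_sub_wsvt //; apply: eq_bigr => i _; congr (_ ^+ 2).
  (* Subtracting the soft threshold from [sigma i] leaves [sigma i] capped at [l * w i]. *)
  by rewrite maxEle minEle subr_le0; case: ifP => _; rewrite ?subr0 ?subKr.
have [s0 smono UU VV YE] := hY.
have -> : frobenius_norm Y ^+ 2 = \sum_i sigma i ^+ 2.
  by rewrite frobenius_normE {1 2}YE mxdot_orthonormal.
move=> eta_lt; have [k [uk [[l0 root] ul]]] := residual_root w_gt0 s0 w_mono smono eta0 eta_lt.
exists k; split=> //; split; first by rewrite psiE.
by move=> l' [l'0]; rewrite psiE => root'; apply: ul.
Qed.
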